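(* Suppose finite sets $X,Y$ satisfy hereditary estimates $$E(A)\ll_\eta K_X|A|^{2+\eta}\quad(A\subset X),\qquad E(B)\ll_\eta K_Y|B|^{2+\eta}\quad(B\subset Y)$$ for every $\eta>0$, where $K_X,K_Y\ge1$. Let $1\le p,q\le2$ and assume $$\frac1p+\frac1q\ge1.$$ Put $$\theta=\max\left\{0,\,3-2\left(\frac1p+\frac1q\right)\right\}.$$ Then for every $\varepsilon>0$ and all $f,g$ supported on $X,Y$ respectively, $$\|f*g\|_{\ell^2}\ll_{p,q,\varepsilon}(K_XK_Y)^{\theta/4}(|X||Y|)^{\varepsilon}\|f\|_{\ell^p}\|g\|_{\ell^q}.$$ The exponent region is sharp up to the subpolynomial loss. If the class contains arithmetic progressions on affine rulings, the joint power of $K_XK_Y$ is also sharp.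
   Context: $X$ and $Y$ are finite subsets of a torsion-free abelian group. For a finite subset $A$ of such a group, $|A|$ is its cardinality and $E(A)=\sum_t r_{A-A}(t)^2$ is its additive energy, with $r_{A-A}(t)=\#\{(x,y)\in A^2:x-y=t\}$. The functions $f,g$ are complex-valued, convolution is $(f*g)(z)=\sum_{x+y=z}f(x)g(y)$, and $\ell^p$ norms are with respect to counting measure. The notation $U\ll_{s}V$ means $U\le CV$ with a constant $C$ depending on the subscripts $s$; in the conclusion the constant may also depend on the implied constants in the hereditary hypotheses. The ''exponent region'' is the set of $(p,q)$ with $1\le p,q\le2$ and $1/p+1/q\ge1$. ''The class'' means the class of finite sets, with their parameters $K_X,K_Y$, to which the inequality is applied (for example, finite subsets of algebraic varieties), and an affine ruling is an affine line contained in the variety carrying the sets.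
   Formalization: For sharpness of the joint power, the class is assumed to contain arbitrarily long progressions P on affine rulings with parameter K at most a constant times |P|; with oversized parameters such as K=|P|^10 a smaller power would suffice. *)

(* Defs.v *)
From HB Require Import structures.
From mathcomp Require Import all_boot all_order all_algebra finmap complex.
From mathcomp Require Import all_classical all_reals all_analysis.

Set Implicit Arguments.
Unset Strict Implicit.
Unset Printing Implicit Defensive.
Import Order.TTheory GRing.Theory Num.Theory.

Local Open Scope fset_scope.
Local Open Scope classical_set_scope.
Local Open Scope ring_scope.

Definition torsion_free (G : zmodType) : Prop :=
  forall (x : G) (n : nat), (0 < n)%N -> x *+ n = 0 -> x = 0.

Definition diff_rep (G : zmodType) (A : {fset G}) (t : G) : nat :=
  #|` [fset xy in (A `*` A)%fset | xy.1 - xy.2 == t]|.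

(* Finitely supported sum over the whole group: diff_rep A t = 0 for t outside
   A - A. *)
Definition energy (G : zmodType) (A : {fset G}) : nat :=
  \sum_(t \in [set: G]) diff_rep A t ^+ 2.

(* Cst eta is the implied constant at eta. *)
Definition hereditary (R : realType) (G : zmodType) (Cst : R -> R) (K : R)
    (X : {fset G}) : Prop :=
  forall eta : R, 0 < eta -> forall A : {fset G}, (A `<=` X)%fset ->
    (energy A)%:R <= Cst eta * K * (#|` A|)%:R `^ (2 + eta).

Definition supported_on (R : realType) (G : zmodType) (f : G -> R[i])
    (X : {fset G}) : Prop :=
  forall x, x \notin X -> f x = 0.

(* The sums below range over finite supports; they are used only for finitely
   supported functions (an infinite support would give the junk value 0). *)
Definition convolution (R : realType) (G : zmodType) (f g : G -> R[i]) (z : G) : R[i] :=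
  \sum_(xy \in [set xy : G * G | xy.1 + xy.2 = z]) f xy.1 * g xy.2.

(* Only 1 <= p <= +oo is meaningful; the value at -oo is junk. *)
Definition lpnorm (R : realType) (G : zmodType) (p : \bar R) (f : G -> R[i]) : R :=
  match p with
  | r%:E => (\sum_(x \in [set: G]) ComplexField.Normc.normc (f x) `^ r) `^ r^-1
  | +oo%E => sup (range (fun x => ComplexField.Normc.normc (f x)))
  | -oo%E => 0
  end.

Definition exponent_region (R : realType) (p q : \bar R) : Prop :=
  [/\ (1 <= p <= 2%:E)%E, (1 <= q <= 2%:E)%E & (1 <= p^-1 + q^-1)%E].

Definition theta (R : realType) (p q : R) : R :=
  Num.max 0 (3 - 2 * (p^-1 + q^-1)).

Definition conv_bound (R : realType) (G : zmodType) (C : R) (p q : \bar R)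
    (kappa eps : R) (X Y : {fset G}) (KX KY : R) : Prop :=
  forall f g : G -> R[i], supported_on f X -> supported_on g Y ->
    lpnorm 2%:E (convolution f g) <=
      C * (KX * KY) `^ kappa * ((#|` X|)%:R * (#|` Y|)%:R) `^ eps
        * lpnorm p f * lpnorm q g.

(* A class of finite sets together with their parameters is a set of pairs
   (X, K); this is the largest class with implied constants Cst. *)
Definition energy_class (R : realType) (G : zmodType) (Cst : R -> R) :
    set ({fset G} * R) :=
  [set XK | 1 <= XK.2 /\ hereditary Cst XK.2 XK.1].

(* The estimate with exponents p, q and joint power kappa, with subpolynomial
   loss, uniformly over X in the class CX and Y in the class CY. *)
Definition conv_estimate_on (R : realType) (G : zmodType)
    (CX CY : set ({fset G} * R)) (p q : \bar R) (kappa : R) : Prop :=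
  forall eps : R, 0 < eps -> exists C : R,
    forall (X : {fset G}) (KX : R) (Y : {fset G}) (KY : R),
      CX (X, KX) -> CY (Y, KY) -> conv_bound C p q kappa eps X Y KX KY.

Definition affine_line (F : fieldType) (W : lmodType F) (L : set W) : Prop :=
  exists a d : W, d != 0 /\ L = range (fun t : F => a + t *: d).

Definition affine_ruling (F : fieldType) (W : lmodType F) (V L : set W) : Prop :=
  affine_line L /\ L `<=` V.

Definition arith_progression (G : zmodType) (n : nat) (P : {fset G}) : Prop :=
  exists a d : G, d != 0 /\ P = [fset (a + d *+ i)%R | i in iota 0 n]%fset.

(* The class contains arbitrarily long progressions P on rulings, with parameter
   of the order of the length.  By E(A) <= |A|^3 the parameter |P| is always
   admissible for P, and since E(P) >> |P|^3 every admissible one is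
   >> |P|^(1 - eta); what is excluded is an artificially oversized parameter,
   for which no power of the parameters could be sharp. *)
Definition contains_progressions_on_rulings (R : realType) (F : fieldType)
    (W : lmodType F) (V : set W) (CC : set ({fset W} * R)) : Prop :=
  exists c : R, forall N : nat, exists (n : nat) (L : set W) (P : {fset W}) (K : R),
    [/\ (N <= n)%N, affine_ruling V L,
        arith_progression n P /\ [set` P] `<=` L,
        CC (P, K) & K <= c * n%:R].

(* Main.v *)
Require Import Defs.
From HB Require Import structures.
From mathcomp Require Import all_boot all_order all_algebra finmap complex.
From mathcomp Require Import all_classical all_reals all_analysis.
From mathcomp Require Import zify ring lra.

Set Implicit Arguments.
Unset Strict Implicit.
Unset Printing Implicit Defensive.
Import Order.TTheory GRing.Theory Num.Theory.

Local Open Scope classical_set_scope.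
Local Open Scope ring_scope.

(** The estimate. For indicators, the square of the l2 norm of 1_A * 1_B is the
    number E(A, B) of solutions of a + b = a' + b' in A and B. Rewriting the
    equation as a - a' = b' - b, E(A, B) is the sum over t of
    r_{A-A}(t) r_{B-B}(t), so that Cauchy-Schwarz gives E(A, B)^2 <= E(A) E(B)
    ([joint_energy_cs]), while r_{A-A} <= |A| gives the two trivial bounds
    |A|^2 |B| and |A| |B|^2 ([joint_energy_le]). The weighted geometric mean of
    these three bounds, with weight theta on the first one, is exactly the claim
    for indicators ([sqrt_joint_energy_le]).

    General functions are reached by a restricted-type argument
    ([restricted_to_strong]): by Markov's inequality the values of u with
    u^p > 2 ||u||_p^p / |A| occupy at most half of A, the other values are
    dominated by a constant multiple of 1_A at a cost O(||u||_p), and halving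
    can be repeated only log_2 |A| times. The logarithms, one for each factor, are
    absorbed in (|X| |Y|)^eps. This replaces both the dyadic decomposition and
    multilinear interpolation.

    Sharpness of the region. Outside the region one exponent exceeds 2, since
    exponents at most 2 satisfy 1/p + 1/q >= 1. The powers of two times a nonzero
    element form a Sidon set S, so E(A) <= 2 |A|^2 for every subset A of S
    ([energy_powers_of_two]), and parameter 1 is admissible; convolving 1_S
    with a point mass would give |S|^(1/2) << |S|^(eps + 1/p) with p > 2.

    Sharpness of the power. A progression P of length n has energy at least
    n^3 / 2, because its difference set has fewer than 2 n elements. If
    kappa >= 0, take f = g = 1_P, with a parameter at most c n. If kappa < 0, take
    for f and g the indicator of one point of P: both sides are then
    insensitive to p and q, and the parameter, which is at least about n^(1/2),
    sends the right-hand side to 0. *)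

(** * Representation counts and joint energy *)

Section Representations.
Variable G : zmodType.
Implicit Types (A B D : {fset G}) (t : G).

Lemma sum_eq_fset (D : {fset G}) (F : G -> nat) (c : G) :
  (\sum_(t <- D) (t == c) * F t = (c \in D) * F c)%N.
Proof.
have [cD|cD] := boolP (c \in D).
  rewrite (big_fsetD1 c) //= eqxx big1_seq ?addn0 // => t /andP[_].
  by rewrite in_fsetD1 => /andP[/negbTE -> _]; rewrite mul0n.
rewrite big1_seq // => t /andP[_ tD].
by case: eqP => [tc|]; rewrite ?mul0n //; rewrite -tc tD in cD.
Qed.

Lemma diff_repE A t : diff_rep A t = (\sum_(y <- A) ((y + t)%R \in A))%N.
Proof.
rewrite /diff_rep -sum1_size; set S := [fset _ in _ | _]%fset.
have -> : S = [fset ((y + t)%R, y) | y in [fset y in A | (y + t)%R \in A]]%fset.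
  apply/fsetP => -[x y]; rewrite !inE /=; apply/idP/imfsetP => /=.
    move=> /andP[/andP[xA yA] /eqP <-]; exists y; rewrite ?inE ?yA /= addrC subrK //.
  move=> [z]; rewrite !inE => /andP[zA ztA] [-> ->].
  by rewrite zA ztA addrC addKr eqxx.
rewrite big_imfset /=; last by move=> ? ? _ _ [].
by rewrite big_fset /= [RHS]big_mkcond [LHS]big_mkcond; apply: eq_bigr => y _; case: ifP.
Qed.
Lemma diff_rep_le A t : (diff_rep A t <= #|` A|)%N.
Proof.
rewrite diff_repE -sum1_size; apply: leq_sum => y _; exact: leq_b1.
Qed.

Lemma diff_rep0 A : diff_rep A 0 = #|` A|.
Proof.
rewrite diff_repE -sum1_size big_seq [RHS]big_seq.
by apply: eq_bigr => y yA; rewrite addr0 yA.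
Qed.

Definition diffset A : {fset G} := [fset (x - y)%R | x in A, y in A]%fset.

Lemma sum_diff A D (F : G -> nat) : (diffset A `<=` D)%fset ->
  (\sum_(a <- A) \sum_(b <- A) F (a - b)%R = \sum_(t <- D) diff_rep A t * F t)%N.
Proof.
move=> AD; under [RHS]eq_bigr do rewrite diff_repE big_distrl /=.
rewrite [RHS]exchange_big [LHS]exchange_big; apply: eq_big_seq => y yA /=.
transitivity (\sum_(t <- D) \sum_(x <- A) (t == x - y)%R * F t)%N; last first.
  apply: eq_bigr => t _; rewrite -big_distrl /=; congr (_ * _)%N.
  have := sum_eq_fset A (fun=> 1%N) (y + t); rewrite muln1 => <-.
  by apply: eq_bigr => x _; rewrite muln1 eq_sym subr_eq addrC.
rewrite exchange_big; apply: eq_big_seq => x xA /=.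
rewrite sum_eq_fset (fsubsetP AD) ?mul1n //.
by apply/imfset2P; exists x => //; exists y.
Qed.

Lemma sum_diff_rep A D : (diffset A `<=` D)%fset ->
  (\sum_(t <- D) diff_rep A t = #|` A| ^ 2)%N.
Proof.
move=> AD; have := sum_diff (fun=> 1%N) AD.
under [X in _ = X]eq_bigr do rewrite muln1.
by move=> <-; rewrite !big_const_seq !count_predT !iter_addn_0 mul1n.
Qed.

Lemma diff_rep_out A t : t \notin diffset A -> diff_rep A t = 0%N.
Proof.
move=> tA; rewrite diff_repE big1_seq // => y /andP[_ yA].
apply/eqP; rewrite eqb0; apply: contra tA => ytA.
by apply/imfset2P; exists (y + t) => //; exists y => //; rewrite addrC addKr.
Qed.

Lemma energyE A D : (diffset A `<=` D)%fset ->
  energy A = (\sum_(t <- D) diff_rep A t ^ 2)%N.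
Proof.
move=> AD; rewrite /energy (fsbigTE D) => [|t tD]; first by apply: eq_bigr.
by rewrite diff_rep_out ?expr0n //; apply: contra tD; exact: (fsubsetP AD).
Qed.

(** The number of solutions of a + b = a' + b', in the form that makes it the
    correlation of the two difference representation functions; see
    [joint_energy_convolution] for the other form. *)
Definition joint_energy A B : nat :=
  (\sum_(a <- A) \sum_(b <- A) diff_rep B (a - b)%R)%N.

Lemma joint_energyE A B D : (diffset A `<=` D)%fset ->
  joint_energy A B = (\sum_(t <- D) diff_rep A t * diff_rep B t)%N.
Proof. exact: sum_diff. Qed.

Lemma joint_energyC A B : joint_energy A B = joint_energy B A.
Proof.
rewrite (@joint_energyE _ _ (diffset A `|` diffset B)%fset) ?fsubsetUl //.
rewrite (@joint_energyE _ _ (diffset A `|` diffset B)%fset) ?fsubsetUr //.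
by apply: eq_bigr => t _; rewrite mulnC.
Qed.

Lemma joint_energy_diag A : joint_energy A A = energy A.
Proof. by rewrite (joint_energyE _ (fsubset_refl _)) (energyE (fsubset_refl _)). Qed.

(** This is ||1_A * 1_B||_2 <= ||1_A||_1 ||1_B||_2, squared. Together with
    [joint_energyC] it gives both endpoints of Young's inequality. *)
Lemma joint_energy_le A B : (joint_energy A B <= #|` A| ^ 2 * #|` B|)%N.
Proof.
rewrite (joint_energyE _ (fsubset_refl _)) -(sum_diff_rep (fsubset_refl _)).
by rewrite big_distrl /=; apply: leq_sum => t _; rewrite leq_mul2l diff_rep_le orbT.
Qed.

Lemma joint_energy1 A x : joint_energy [fset x]%fset A = #|` A|.
Proof. by rewrite /joint_energy !big_seq_fset1 subrr diff_rep0. Qed.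

End Representations.

(** * Cauchy-Schwarz and the finite l2 norm *)

Section L2.
Variable R : realType.

Lemma cauchy_schwarz_sum (I : Type) (s : seq I) (a b : I -> R) :
  (\sum_(i <- s) a i * b i) ^+ 2 <= (\sum_(i <- s) a i ^+ 2) * (\sum_(i <- s) b i ^+ 2).
Proof.
set P := \sum_(i <- s) a i * b i; set U := \sum_(i <- s) a i ^+ 2.
set V := \sum_(i <- s) b i ^+ 2.
have U0 : 0 <= U by apply: sumr_ge0 => i _; exact: sqr_ge0.
have V0 : 0 <= V by apply: sumr_ge0 => i _; exact: sqr_ge0.
(* discriminant argument: the quadratic form of the pencil x a - y b *)
have Q x y : 0 <= x ^+ 2 * U - 2 * x * y * P + y ^+ 2 * V.
  suff -> : x ^+ 2 * U - 2 * x * y * P + y ^+ 2 * V =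
      \sum_(i <- s) (x * a i - y * b i) ^+ 2.
    by apply: sumr_ge0 => i _; exact: sqr_ge0.
  rewrite !mulr_sumr -sumrB -big_split /=; apply: eq_bigr => i _; ring.
have [V00|Vp] := eqVneq V 0.
  have := Q 1 (P * (U + 1)); have := Q P (U + 1); rewrite V00 => h1 h2; nra.
have := Q V P; have : 0 < V by rewrite lt_def Vp.
move=> V1 h; have : 0 <= V * (V * U - P ^+ 2) by nra.
by rewrite pmulr_rge0 // subr_ge0 mulrC.
Qed.

Definition l2 (I : Type) (s : seq I) (a : I -> R) : R := Num.sqrt (\sum_(i <- s) a i ^+ 2).

Lemma l2_triangle (I : Type) (s : seq I) (a b : I -> R) :
  l2 s (fun i => a i + b i) <= l2 s a + l2 s b.
Proof.
have S0 (c : I -> R) : 0 <= \sum_(i <- s) c i ^+ 2.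
  by apply: sumr_ge0 => i _; exact: sqr_ge0.
rewrite -(@ler_pXn2r _ 2) ?nnegrE ?addr_ge0 ?sqrtr_ge0 // sqrrD !sqr_sqrtr //.
have -> : \sum_(i <- s) (a i + b i) ^+ 2 = \sum_(i <- s) a i ^+ 2
    + (\sum_(i <- s) a i * b i) *+ 2 + \sum_(i <- s) b i ^+ 2.
  rewrite -sumrMnl -!big_split /=; apply: eq_bigr => i _; ring.
rewrite lerD2r lerD2l lerMn2r /= -sqrtrM //.
rewrite (le_trans (ler_norm _)) // -sqrtr_sqr ler_sqrt ?mulr_ge0 //.
exact: cauchy_schwarz_sum.
Qed.

Lemma l2_mono (I : Type) (s : seq I) (a b : I -> R) :
  (forall i, 0 <= a i <= b i) -> l2 s a <= l2 s b.
Proof.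
move=> h; rewrite ler_sqrt; last by apply: sumr_ge0 => i _; exact: sqr_ge0.
apply: ler_sum => i _; have /andP[a0 ab] := h i.
by rewrite ler_pXn2r ?nnegrE // (le_trans a0).
Qed.

Lemma l2Z (I : Type) (s : seq I) (a : I -> R) c : 0 <= c ->
  l2 s (fun i => c * a i) = c * l2 s a.
Proof.
move=> c0; rewrite /l2; under eq_bigr do rewrite exprMn.
by rewrite -mulr_sumr sqrtrM ?sqr_ge0 // sqrtr_sqr ger0_norm.
Qed.

Variable G : zmodType.
Implicit Types A B : {fset G}.

Lemma joint_energy_cs A B :
  ((joint_energy A B)%:R ^+ 2 : R) <= (energy A)%:R * (energy B)%:R.
Proof.
pose D := (diffset A `|` diffset B)%fset.
rewrite (@joint_energyE _ A B D) ?fsubsetUl // (@energyE _ A D) ?fsubsetUl //.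
rewrite (@energyE _ B D) ?fsubsetUr // !natr_sum.
under eq_bigr do rewrite natrM.
apply: (le_trans (cauchy_schwarz_sum _ _ _)).
rewrite le_eqVlt; apply/orP; left; apply/eqP; congr (_ * _).
  by apply: eq_bigr => t _; rewrite natrX.
by apply: eq_bigr => t _; rewrite natrX.
Qed.
End L2.

(** * Convolutions and norms as finite sums *)

Local Notation normc := ComplexField.Normc.normc.
Section Norms.
Variables (R : realType) (G : zmodType).
Implicit Types (A B X Y D : {fset G}) (f g : G -> R[i]) (u v : G -> R).

Definition sumset A B : {fset G} := [fset (x + y)%R | x in A, y in B]%fset.

Lemma convolutionE f g X z : supported_on f X ->
  convolution f g z = \sum_(x <- X) f x * g (z - x).
Proof.
move=> fX; rewrite /convolution.
rewrite (reindex_fsbig (fun x => (x, z - x)) [set: G]) /=; last first.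
  split.
  - by move=> x _ /=; rewrite addrC subrK.
  - by move=> x y _ _ [].
  - by move=> [x y] /= <-; exists x => //; rewrite addrC addKr.
by apply: fsbigTE => x xX; rewrite fX // mul0r.
Qed.

Lemma normc_ge0 (z : R[i]) : 0 <= normc z.
Proof. by case: z => a b; exact: sqrtr_ge0. Qed.

Lemma normc_nat n : normc (n%:R : R[i]) = n%:R.
Proof. by rewrite (@normcMn R 1 n) ComplexField.Normc.normc1. Qed.

Lemma normc_sum (I : Type) (s : seq I) (F : I -> R[i]) :
  normc (\sum_(i <- s) F i) <= \sum_(i <- s) normc (F i).
Proof.
elim/big_rec2: _ => [|i y x _ h]; first by rewrite ComplexField.Normc.normc0.
by apply: (le_trans (le_normcD _ _)); rewrite lerD2l.
Qed.

Lemma lpnormE f X r : supported_on f X -> 0 < r ->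
  lpnorm r%:E f = (\sum_(x <- X) normc (f x) `^ r) `^ r^-1.
Proof.
move=> fX r0 /=; congr (_ `^ _); apply: fsbigTE => x xX.
by rewrite fX // ComplexField.Normc.normc0 powR0 // gt_eqF.
Qed.

Lemma lpnorm2E f X : supported_on f X ->
  lpnorm 2%:E f = l2 X (fun x => normc (f x)).
Proof.
move=> fX; rewrite (lpnormE fX) // powR12_sqrt; last first.
  by apply: sumr_ge0 => x _; exact: powR_ge0.
by congr Num.sqrt; apply: eq_bigr => x _; rewrite powR_mulrn // normc_ge0.
Qed.

Lemma supported_convolution f g X Y : supported_on f X -> supported_on g Y ->
  supported_on (convolution f g) (sumset X Y).
Proof.
move=> fX gY z zXY; rewrite (convolutionE _ _ fX) big1_seq // => x /andP[_ xX].
rewrite gY ?mulr0 //; apply: contra zXY => zY.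
by apply/imfset2P; exists x => //; exists (z - x) => //; rewrite addrC subrK.
Qed.

(** Only the support of the first function is summed over, which makes the
    convolution visibly bilinear without any support condition on [v]. *)
Definition rconv X u v z : R := \sum_(x <- X) u x * v (z - x).

Lemma lpnorm2_convolution_le f g X Y : supported_on f X -> supported_on g Y ->
  lpnorm 2%:E (convolution f g) <=
    l2 (sumset X Y) (rconv X (fun x => normc (f x)) (fun y => normc (g y))).
Proof.
move=> fX gY; rewrite (lpnorm2E (supported_convolution fX gY)).
apply: l2_mono => z; rewrite normc_ge0 (convolutionE _ _ fX).
apply: (le_trans (normc_sum _ _)); apply: ler_sum => x _.
by rewrite ComplexField.Normc.normcM.
Qed.

(** Expanding the square gives pairs a, a' and z with z - a and z - a' in B;
    substituting z = a + b counts the b with b + (a - a') in B. *)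
Lemma joint_energy_convolution A B D : (sumset A B `<=` D)%fset ->
  joint_energy A B = (\sum_(z <- D) (\sum_(a <- A) ((z - a)%R \in B)) ^ 2)%N.
Proof.
move=> ABD; under [RHS]eq_bigr => z _.
  rewrite -mulnn big_distrl /=; under eq_bigr do rewrite big_distrr /=.
  over.
rewrite [RHS]exchange_big; apply: eq_big_seq => a aA /=.
rewrite [RHS]exchange_big; apply: eq_big_seq => a' a'A /=.
transitivity (\sum_(z <- D) \sum_(b <- B) (z == a + b)%R * ((z - a')%R \in B))%N.
  rewrite exchange_big diff_repE; apply: eq_big_seq => b bB /=.
  rewrite sum_eq_fset (fsubsetP ABD) ?mul1n; first by rewrite addrCA addrA.
  by apply/imfset2P; exists a => //; exists b.
apply: eq_bigr => z _; rewrite -big_distrl /=; congr (_ * _)%N.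
have := sum_eq_fset B (fun=> 1%N) (z - a); rewrite muln1 => <-.
by apply: eq_bigr => b _; rewrite muln1 [b == _]eq_sym subr_eq [a + b]addrC.
Qed.

Definition fset_ind A (x : G) : R := (x \in A)%:R.

Lemma l2_rconv_ind A B X D : (A `<=` X)%fset -> (sumset A B `<=` D)%fset ->
  l2 D (rconv X (fset_ind A) (fset_ind B)) = Num.sqrt (joint_energy A B)%:R.
Proof.
move=> AX ABD; congr Num.sqrt; rewrite (joint_energy_convolution ABD) natr_sum.
apply: eq_bigr => z _; rewrite natrX; congr (_ ^+ 2); rewrite natr_sum /rconv.
rewrite -(big_fset_incl _ AX) => [|x _ /negbTE xA]; last first.
  by rewrite /fset_ind xA mul0r.
by apply: eq_big_seq => x xA; rewrite /fset_ind xA mul1r.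
Qed.

Definition cind A (x : G) : R[i] := (x \in A)%:R.

Lemma supported_cind A : supported_on (cind A) A.
Proof. by move=> x /negbTE xA; rewrite /cind xA. Qed.

Lemma lpnorm2_convolution_cind A B :
  lpnorm 2%:E (convolution (cind A) (cind B)) = Num.sqrt (joint_energy A B)%:R.
Proof.
rewrite (lpnorm2E (supported_convolution (@supported_cind A) (@supported_cind B))).
congr Num.sqrt; rewrite (joint_energy_convolution (fsubset_refl _)) natr_sum.
apply: eq_bigr => z _; rewrite natrX (convolutionE _ _ (@supported_cind A)).
congr (_ ^+ 2); rewrite -normc_nat natr_sum; congr normc.
by apply: eq_big_seq => x xA; rewrite /cind xA mul1r.
Qed.

Lemma lpnorm_cind A r : 0 < r -> lpnorm r%:E (cind A) = (#|` A|)%:R `^ r^-1.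
Proof.
move=> r0; rewrite (lpnormE (@supported_cind A)) //; congr (_ `^ _).
rewrite -sum1_size natr_sum; apply: eq_big_seq => x xA.
by rewrite normc_nat xA powR1.
Qed.

Lemma lpnorm_cind_infty A : lpnorm +oo%E (cind A) <= 1.
Proof.
apply: ge_sup; first by exists (normc (cind A 0)), 0.
by move=> _ [x _ <-]; rewrite normc_nat lern1 leq_b1.
Qed.
End Norms.

(** * From indicators to general functions *)

Section Restricted.
Variables (R : realType) (T : choiceType).
Implicit Types (A X : {fset T}).

Lemma sum_fset_le A X (F : T -> R) : (A `<=` X)%fset -> (forall x, 0 <= F x) ->
  \sum_(x <- A) F x <= \sum_(x <- X) F x.
Proof.
move=> AX F0; apply: (@le_trans _ _ (\sum_(x <- A) (x \in A)%:R * F x)).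
  rewrite le_eqVlt (eq_big_seq (fun x => (x \in A)%:R * F x)) ?eqxx //.
  by move=> x ->; rewrite mul1r.
rewrite (big_fset_incl _ AX) => [|x _ /negbTE ->]; last by rewrite mul0r.
by apply: ler_sum => x _; rewrite ler_piMl // lern1 leq_b1.
Qed.

(** A bound on indicators extends to all functions at the cost of a logarithm:
    each induction step splits off the small values, which are at most
    (2 S / |A|)^(1/p) and so cost at most 2 M S^(1/p), and leaves at most half
    of the set. *)
Lemma restricted_to_strong (N : (T -> R) -> R) X (p M : R) :
  (forall u v, N (fun x => u x + v x) <= N u + N v) ->
  (forall u v, (forall x, 0 <= u x <= v x) -> N u <= N v) ->
  (forall c u, 0 <= c -> N (fun x => c * u x) = c * N u) ->
  1 <= p -> 0 <= M ->
  (forall A, (A `<=` X)%fset -> N (fun x => (x \in A)%:R) <= M * (#|` A|)%:R `^ p^-1) ->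
  forall u, (forall x, 0 <= u x) -> forall k A, (A `<=` X)%fset -> (#|` A| < 2 ^ k)%N ->
  N (fun x => (x \in A)%:R * u x) <=
    (2 * k%:R * M) * (\sum_(x <- X) u x `^ p) `^ p^-1.
Proof.
move=> Nadd Nmono Nscale p1 M0 Nind u u0; set S := \sum_(x <- X) _.
have p0 : 0 < p by rewrite (lt_le_trans _ p1).
have S0 : 0 <= S by apply: sumr_ge0 => x _; exact: powR_ge0.
elim=> [|k IH] A AX Ak.
  have /cardfs0_eq -> : #|` A| = 0%N by move: Ak; rewrite expn0; case: #|` A|.
  rewrite mulr0 !mul0r; apply: le_trans (Nmono _ (fun x => (x \in fset0)%:R) _) _.
    by move=> x; rewrite in_fset0 mul0r lexx.
  apply: (le_trans (Nind _ (fsub0set _))).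
  by rewrite cardfs0 powR0 ?mulr0 // invr_neq0 // gt_eqF.
pose a : R := (#|` A|)%:R.
pose B := [fset x in A | u x `^ p * a > 2 * S]%fset.
have BA : (B `<=` A)%fset by exact: fset_sub.
(* Markov: each point of B contributes more than 2 S / a to the sum, at most S *)
have Bhalf : (2 * #|` B| <= #|` A|)%N.
  have [->|[x0 x0B]] := fset_0Vmem B; first by rewrite cardfs0 muln0.
  have h1 : (#|` B|)%:R * (2 * S) < S * a.
    apply: (@lt_le_trans _ _ (\sum_(x <- B) u x `^ p * a)).
      rewrite -sum1_size natr_sum mulr_suml (big_fsetD1 x0) //= [ltRHS](big_fsetD1 x0) //=.
      apply: ltr_leD; first by move: x0B; rewrite !inE mul1r => /andP[].
      rewrite big_seq [leRHS]big_seq; apply: ler_sum => x; rewrite !inE mul1r.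
      by move=> /and3P[_ _ /ltW].
    rewrite -mulr_suml ler_wpM2r ?ler0n // /S.
    apply: sum_fset_le; last by move=> x; exact: powR_ge0.
    exact: fsubset_trans AX.
  have : (#|` B|)%:R * 2 * S < a * S by rewrite -mulrA [ltRHS]mulrC.
  have [S00|Sn] := eqVneq S 0; first by rewrite S00 !mulr0 ltxx.
  have Sp : 0 < S by rewrite lt_def Sn.
  rewrite (ltr_pM2r Sp) /a -natrM ltr_nat mulnC; exact: ltnW.
have Bk : (#|` B| < 2 ^ k)%N.
  by move: Ak Bhalf; rewrite expnS; move: (2 ^ k)%N => K; lia.
have [A0|An] := eqVneq #|` A| 0%N.
  move: Bk; rewrite (cardfs0_eq A0) => Bk.
  have h0 : (#|` (fset0 : {fset T})| < 2 ^ k)%N by rewrite cardfs0 expn_gt0.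
  apply: (le_trans (IH _ (fsub0set _) h0)).
  by rewrite ler_wpM2r ?powR_ge0 // ler_wpM2r // ler_wpM2l // ler_nat.
have a0 : 0 < a by rewrite ltr0n lt0n.
pose c := (2 * S / a) `^ p^-1.
have c0 : 0 <= c by exact: powR_ge0.
apply: (@le_trans _ _ (N (fun x => (x \in B)%:R * u x + c * (x \in A)%:R))).
  apply: Nmono => x; rewrite mulr_ge0 //=.
  rewrite !inE /=; case: (boolP (x \in A)) => [xA|xA]; last by rewrite !mul0r mulr0 addr0.
  rewrite mul1r mulr1; case: ltP => [_|le]; first by rewrite mul1r lerDl.
  rewrite mul0r add0r /c (_ : u x = (u x `^ p) `^ p^-1); last first.
    by rewrite -powRrM divff ?gt_eqF // powRr1.
  apply: ge0_ler_powR; first by rewrite invr_ge0 ltW.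
  - by rewrite nnegrE powR_ge0.
  - by rewrite nnegrE divr_ge0 ?mulr_ge0.
  - by rewrite ler_pdivlMr.
apply: (le_trans (Nadd _ _)); rewrite Nscale //.
have := lerD (IH _ (fsubset_trans BA AX) Bk) (ler_wpM2l c0 (Nind _ AX)).
move/le_trans; apply.
have -> : c * (M * a `^ p^-1) = M * 2 `^ p^-1 * S `^ p^-1.
  rewrite mulrCA -powRM ?divr_ge0 ?mulr_ge0 ?(ltW a0) // divfK ?gt_eqF //.
  by rewrite powRM // mulrA.
rewrite -mulrDl ler_wpM2r ?powR_ge0 // -[k.+1%:R]natr1 mulrDr mulr1 mulrDl lerD2l mulrC.
by rewrite ler_wpM2r // ler1_powR ?ler1n // invf_le1.
Qed.

(** From 2^k <= n follows n^e >= 1 + k e ln 2, so the number k + 1 of halvings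
    of a set of n elements is absorbed in n^e. *)
Lemma exists_log_bound (e : R) : 0 < e -> exists2 C : R, 0 <= C &
  forall n : nat, exists2 k : nat, (n < 2 ^ k)%N & 2 * k%:R <= C * n%:R `^ e.
Proof.
move=> e0; have ln2 : 0 < ln (2 : R) by rewrite ln_gt0 // ltr1n.
have eln : 0 < e * ln 2 by exact: mulr_gt0.
exists (2 * (1 + (e * ln 2)^-1)).
  by rewrite mulr_ge0 // addr_ge0 // invr_ge0 ltW.
case=> [|n]; first by exists 0%N => //; rewrite mulr0 powR0 ?mulr0 // gt_eqF.
have /andP[lo hi] := trunc_log_bounds (isT : (1 < 2)%N) (ltn0Sn n).
set k := trunc_log 2 n.+1 in lo hi; exists k.+1 => //.
rewrite -mulrA ler_wpM2l //.
have h1 : 1 + k%:R * (e * ln 2) <= n.+1%:R `^ e.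
  apply: (@le_trans _ _ ((2 ^ k)%:R `^ e)); last first.
    by rewrite ge0_ler_powR ?nnegrE ?ler0n ?ler_nat // ltW.
  rewrite natrX -powR_mulrn // -powRrM /powR gt_eqF //.
  by apply: (le_trans (expR_ge1Dx _)); rewrite mulrA.
have h2 := ler_wpM2l (_ : 0 <= 1 + (e * ln 2)^-1) h1.
apply: le_trans (h2 _); last by rewrite addr_ge0 // invr_ge0 ltW.
have e1 := mulVf (lt0r_neq0 eln); rewrite -[k.+1%:R]natr1.
set c := (e * ln 2)^-1 in e1 *; set w := e * ln 2 in eln e1 *.
have -> : (1 + c) * (1 + k%:R * w) = k%:R + 1 + (k%:R * w + c) + k%:R * (c * w - 1) by ring.
have c0 : 0 <= c by rewrite invr_ge0 ltW.
by rewrite e1 subrr mulr0 addr0 lerDl addr_ge0 // mulr_ge0 // ltW.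
Qed.
End Restricted.

(** * The convolution estimate *)

Section Inequality.
Variable R : realType.
Section Bilinear.
Variable G : zmodType.
Implicit Types (A B X Y D : {fset G}) (u v : G -> R).

Lemma fset_ind_ge0 A x : 0 <= fset_ind R A x. Proof. exact: ler0n. Qed.

Lemma l2_rconv_addl X D u u' v : l2 D (rconv X (fun x => u x + u' x) v) <=
  l2 D (rconv X u v) + l2 D (rconv X u' v).
Proof.
apply: le_trans (l2_triangle _ _ _); rewrite /l2 le_eqVlt; apply/orP; left; apply/eqP.
congr Num.sqrt; apply: eq_bigr => z _; congr (_ ^+ 2); rewrite -big_split /=.
by apply: eq_bigr => x _; rewrite mulrDl.
Qed.

Lemma l2_rconv_addr X D u v v' : l2 D (rconv X u (fun x => v x + v' x)) <=
  l2 D (rconv X u v) + l2 D (rconv X u v').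
Proof.
apply: le_trans (l2_triangle _ _ _); rewrite /l2 le_eqVlt; apply/orP; left; apply/eqP.
congr Num.sqrt; apply: eq_bigr => z _; congr (_ ^+ 2); rewrite -big_split /=.
by apply: eq_bigr => x _; rewrite mulrDr.
Qed.

Lemma l2_rconvZl X D u v c : 0 <= c ->
  l2 D (rconv X (fun x => c * u x) v) = c * l2 D (rconv X u v).
Proof.
move=> c0; rewrite -l2Z //; congr Num.sqrt; apply: eq_bigr => z _; congr (_ ^+ 2).
by rewrite mulr_sumr; apply: eq_bigr => x _; rewrite mulrA.
Qed.

Lemma l2_rconvZr X D u v c : 0 <= c ->
  l2 D (rconv X u (fun x => c * v x)) = c * l2 D (rconv X u v).
Proof.
move=> c0; rewrite -l2Z //; congr Num.sqrt; apply: eq_bigr => z _; congr (_ ^+ 2).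
by rewrite mulr_sumr; apply: eq_bigr => x _; rewrite mulrCA.
Qed.

Lemma l2_rconv_mono X D u u' v v' :
  (forall x, 0 <= u x <= u' x) -> (forall x, 0 <= v x <= v' x) ->
  l2 D (rconv X u v) <= l2 D (rconv X u' v').
Proof.
move=> uu vv; apply: l2_mono => z; apply/andP; split.
  apply: sumr_ge0 => x _; have /andP[u0 _] := uu x.
  by have /andP[v0 _] := vv (z - x); exact: mulr_ge0.
apply: ler_sum => x _; have /andP[u0 ?] := uu x.
by have /andP[v0 ?] := vv (z - x); exact: ler_pM.
Qed.

(** [restricted_to_strong] is used twice: in the first variable against each
    indicator 1_B, then in the second variable with the first function fixed. *)
Lemma conv_bound_of_indicators (f g : G -> R[i]) X Y (p q M : R) (k l : nat) :
  supported_on f X -> supported_on g Y -> 1 <= p -> 1 <= q -> 0 <= M ->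
  (#|` X| < 2 ^ k)%N -> (#|` Y| < 2 ^ l)%N ->
  (forall A B, (A `<=` X)%fset -> (B `<=` Y)%fset ->
    Num.sqrt (joint_energy A B)%:R <=
      M * (#|` A|)%:R `^ p^-1 * (#|` B|)%:R `^ q^-1) ->
  lpnorm 2%:E (convolution f g) <=
    (2 * k%:R) * (2 * l%:R) * M * lpnorm p%:E f * lpnorm q%:E g.
Proof.
move=> fX gY p1 q1 M0 Xk Yl H.
have p0 : 0 < p by rewrite (lt_le_trans _ p1).
have q0 : 0 < q by rewrite (lt_le_trans _ q1).
apply: (le_trans (lpnorm2_convolution_le fX gY)).
set D := sumset X Y; set u := (fun x => _); set v := (fun y => _).
have u0 x : 0 <= u x by exact: normc_ge0.
have v0 x : 0 <= v x by exact: normc_ge0.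
have uE : u = (fun x => (x \in X)%:R * u x).
  apply/funext => x; case: (boolP (x \in X)) => xX; rewrite ?mul1r // mul0r /u.
  by rewrite fX // ComplexField.Normc.normc0.
have vE : v = (fun x => (x \in Y)%:R * v x).
  apply/funext => x; case: (boolP (x \in Y)) => xY; rewrite ?mul1r // mul0r /v.
  by rewrite gY // ComplexField.Normc.normc0.
have nf : lpnorm p%:E f = (\sum_(x <- X) u x `^ p) `^ p^-1 by exact: lpnormE.
have ng : lpnorm q%:E g = (\sum_(x <- Y) v x `^ q) `^ q^-1 by exact: lpnormE.
have nf0 : 0 <= lpnorm p%:E f by rewrite nf powR_ge0.
have step1 B : (B `<=` Y)%fset -> l2 D (rconv X u (fset_ind R B)) <=
    (2 * k%:R * M * lpnorm p%:E f) * (#|` B|)%:R `^ q^-1.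
  move=> BY; rewrite uE.
  have := @restricted_to_strong R G (fun w => l2 D (rconv X w (fset_ind R B))) X p
    (M * (#|` B|)%:R `^ q^-1).
  move=> /(_ _ _ _ p1 _ _ u u0 k X (fsubset_refl _) Xk).
  rewrite -nf => h; apply: le_trans (h _ _ _ _ _) _.
  - by move=> w w'; exact: l2_rconv_addl.
  - move=> w w' ww; apply: l2_rconv_mono => // x; by rewrite fset_ind_ge0 lexx.
  - by move=> c w; exact: l2_rconvZl.
  - by rewrite mulr_ge0 // powR_ge0.
  - move=> A AX; rewrite (l2_rconv_ind _ AX).
      by rewrite mulrAC; exact: H.
    apply/fsubsetP => _ /imfset2P[x xA [y yB ->]]; apply/imfset2P.
    by exists x; [exact: (fsubsetP AX)|exists y => //; exact: (fsubsetP BY)].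
  - by rewrite le_eqVlt; apply/orP; left; apply/eqP; ring.
rewrite {1}vE.
have := @restricted_to_strong R G (fun w => l2 D (rconv X u w)) Y q
  (2 * k%:R * M * lpnorm p%:E f).
move=> /(_ _ _ _ q1 _ _ v v0 l Y (fsubset_refl _) Yl).
rewrite -ng => h; apply: le_trans (h _ _ _ _ _) _.
- by move=> w w'; exact: l2_rconv_addr.
- move=> w w' ww; apply: l2_rconv_mono => // x; by rewrite u0 lexx.
- by move=> c w; exact: l2_rconvZr.
- by rewrite !mulr_ge0.
- exact: step1.
- by rewrite le_eqVlt; apply/orP; left; apply/eqP; ring.
Qed.
End Bilinear.

Lemma exponent_region_real (p q : R) : exponent_region p%:E q%:E ->
  [/\ 1 <= p, 1 <= q, 2^-1 <= p^-1 <= 1 & 2^-1 <= q^-1 <= 1].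
Proof.
have inv (r : R) : 1 <= r <= 2 -> 2^-1 <= r^-1 <= 1.
  move=> /andP[r1 r2]; have r0 : 0 < r by rewrite (lt_le_trans _ r1).
  by rewrite lef_pV2 ?posrE // r2 invf_le1.
move=> [hp hq _]; rewrite !lee_fin in hp hq.
by split; [case/andP: hp|case/andP: hq|exact: inv|exact: inv].
Qed.

(** The weights of the three bounds E(A)^(1/2) E(B)^(1/2), |A|^2 |B| and
    |A| |B|^2 in their geometric mean. For energies |A|^2 and |B|^2 the mean has
    square root |A|^((1 + a) / 2) |B|^((1 + b) / 2). The last
    inequality is strict only when 1/p + 1/q > 3/2, where theta stays 0. *)
Lemma interpolation_weights (P Q : R) : 2^-1 <= P <= 1 -> 2^-1 <= Q <= 1 ->
  exists t a b : R, [/\ t = Num.max 0 (3 - 2 * (P + Q)), 0 <= t <= 1, 0 <= a, 0 <= b &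
    [/\ t + a + b = 1, (1 + a) / 2 = P & (1 + b) / 2 <= Q]].
Proof.
move=> /andP[P1 P2] /andP[Q1 Q2]; set t := Num.max _ _.
exists t, (2 * P - 1), (2 - 2 * P - t); rewrite /t.
by case: (leP 0 (3 - 2 * (P + Q))) => h; split;
  [by []|lra|lra|lra|split; lra|by []|lra|lra|lra|split; lra].
Qed.

(** The geometric mean of the three bounds, after taking logarithms: [lE] stands
    for ln E(A, B), [lM] for the logarithm of the constants and parameters, [la]
    and [lb] for ln |A| and ln |B|, [lN] for ln (|X| |Y|). *)
Lemma weighted_log_bound (t a b lE lM la lb lN e P Q : R) :
  0 <= t <= 1 -> 0 <= a -> 0 <= b -> t + a + b = 1 ->
  (1 + a) / 2 = P -> (1 + b) / 2 <= Q -> 0 <= e -> 0 <= la -> 0 <= lb -> la + lb <= lN ->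
  2 * lE <= lM + (2 + 2 * e) * (la + lb) -> lE <= 2 * la + lb -> lE <= la + 2 * lb ->
  lE / 2 <= t / 4 * lM + e / 2 * lN + P * la + Q * lb.
Proof.
move=> /andP[t0 t1] a0 b0 tab <- hQ e0 la0 lb0 hN h1 h2 h3.
(* lE / 2 = t / 4 * (2 lE) + a / 2 * lE + b / 2 * lE *)
have k1 : t / 4 * (2 * lE) <= t / 4 * (lM + (2 + 2 * e) * (la + lb)).
  by rewrite ler_wpM2l //; lra.
have k2 : a / 2 * lE <= a / 2 * (2 * la + lb) by rewrite ler_wpM2l //; lra.
have k3 : b / 2 * lE <= b / 2 * (la + 2 * lb) by rewrite ler_wpM2l //; lra.
have k4 : t * (e * (la + lb)) <= e * (la + lb) by rewrite ler_piMl // mulr_ge0 // addr_ge0.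
have k5 : e / 2 * (la + lb) <= e / 2 * lN by rewrite ler_wpM2l // divr_ge0.
have k6 : (1 + b) / 2 * lb <= Q * lb by rewrite ler_wpM2r.
have bE : b = 1 - t - a by lra.
rewrite {}bE in k3 k6 *; lra.
Qed.

(** The constants are replaced by their maximum with 1 so that logarithms can be
    taken. The loss eps / 2 leaves room for the two logarithms of
    [conv_bound_of_indicators]. *)
Lemma sqrt_joint_energy_le (G : zmodType) (X Y A B : {fset G}) (CstX CstY : R -> R)
    (KX KY p q e : R) :
  exponent_region p%:E q%:E -> 0 < e -> 1 <= KX -> 1 <= KY ->
  hereditary CstX KX X -> hereditary CstY KY Y -> (A `<=` X)%fset -> (B `<=` Y)%fset ->
  Num.sqrt (joint_energy A B)%:R <=
    (Num.max 1 (CstX (2 * e)) * Num.max 1 (CstY (2 * e))) `^ (theta p q / 4) *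
    (KX * KY) `^ (theta p q / 4) * ((#|` X|)%:R * (#|` Y|)%:R) `^ (e / 2) *
    (#|` A|)%:R `^ p^-1 * (#|` B|)%:R `^ q^-1.
Proof.
move=> pq e0 KX1 KY1 hX hY AX BY.
have [p1 q1 hP hQ] := exponent_region_real pq.
set c1 := Num.max 1 (CstX _); set c2 := Num.max 1 (CstY _).
have c11 : 1 <= c1 by rewrite le_max lexx.
have c21 : 1 <= c2 by rewrite le_max lexx.
have [E0|En] := eqVneq (joint_energy A B) 0%N.
  by rewrite E0 sqrtr0 !mulr_ge0 ?powR_ge0.
set E : R := (joint_energy A B)%:R; set a : R := (#|` A|)%:R; set b : R := (#|` B|)%:R.
have E1 : 0 < E by rewrite ltr0n lt0n.
have An : (0 < #|` A|)%N.
  by move: (joint_energy_le A B) En; case: #|` A| => //; rewrite mul0n leqn0 => ->.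
have Bn : (0 < #|` B|)%N.
  by move: (joint_energy_le A B) En; case: #|` B| => //; rewrite muln0 leqn0 => ->.
have Xn := leq_trans An (fsubset_leq_card AX).
have Yn := leq_trans Bn (fsubset_leq_card BY).
have a1 : 1 <= a by rewrite ler1n.
have b1 : 1 <= b by rewrite ler1n.
have a0 : 0 < a by rewrite ltr0n.
have b0 : 0 < b by rewrite ltr0n.
have X0 : 0 < (#|` X|)%:R :> R by rewrite ltr0n.
have Y0 : 0 < (#|` Y|)%:R :> R by rewrite ltr0n.
have c10 : 0 < c1 by rewrite (lt_le_trans _ c11).
have c20 : 0 < c2 by rewrite (lt_le_trans _ c21).
have KX0 : 0 < KX by rewrite (lt_le_trans _ KX1).
have KY0 : 0 < KY by rewrite (lt_le_trans _ KY1).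
have [t [wa [wb [tE t01 wa0 wb0 [sum1 hwa hwb]]]]] := interpolation_weights hP hQ.
rewrite /theta -tE.
have pos := (mulr_gt0, powR_gt0).
rewrite -powR12_sqrt ?(ltW E1) // -ler_ln ?posrE ?pos //.
rewrite !lnM ?posrE ?pos // !ln_powR !lnM ?posrE ?pos //.
have bound1 : 2 * ln E <= ln c1 + ln c2 + (ln KX + ln KY) + (2 + 2 * e) * (ln a + ln b).
  have e20 : 0 < 2 * e by rewrite mulr_gt0.
  have EA : (energy A)%:R <= c1 * KX * a `^ (2 + 2 * e).
    apply: (le_trans (hX _ e20 _ AX)).
    by rewrite ler_wpM2r ?powR_ge0 // ler_wpM2r ?(ltW KX0) // le_max lexx orbT.
  have EB : (energy B)%:R <= c2 * KY * b `^ (2 + 2 * e).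
    apply: (le_trans (hY _ e20 _ BY)).
    by rewrite ler_wpM2r ?powR_ge0 // ler_wpM2r ?(ltW KY0) // le_max lexx orbT.
  have := le_trans (joint_energy_cs R A B) (ler_pM (ler0n _ _) (ler0n _ _) EA EB).
  rewrite -/E -ler_ln ?posrE ?exprn_gt0 ?pos // expr2.
  rewrite !lnM ?posrE ?pos // !ln_powR; lra.
have bound2 : ln E <= 2 * ln a + ln b.
  have : E <= a * a * b by rewrite -!natrM ler_nat mulnn joint_energy_le.
  rewrite -ler_ln ?posrE ?pos // !lnM ?posrE ?pos //; lra.
have bound3 : ln E <= ln a + 2 * ln b.
  have : E <= b * b * a by rewrite -!natrM ler_nat /E joint_energyC mulnn joint_energy_le.
  rewrite -ler_ln ?posrE ?pos // !lnM ?posrE ?pos //; lra.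
have := @weighted_log_bound t wa wb (ln E) (ln c1 + ln c2 + (ln KX + ln KY)) (ln a) (ln b)
  (ln (#|` X|)%:R + ln (#|` Y|)%:R) e p^-1 q^-1 t01 wa0 wb0 sum1 hwa hwb (ltW e0)
  (ln_ge0 a1) (ln_ge0 b1).
rewrite lerD ?ler_ln ?posrE ?ler_nat ?fsubset_leq_card // => /(_ isT bound1 bound2 bound3).
lra.
Qed.

Lemma convolution_estimate (p q : R) : exponent_region p%:E q%:E ->
   forall (CstX CstY : R -> R) (eps : R), 0 < eps ->
   exists C : R,
     forall (G : zmodType) (X Y : {fset G}) (KX KY : R),
       1 <= KX -> 1 <= KY ->
       hereditary CstX KX X -> hereditary CstY KY Y ->
       conv_bound C p%:E q%:E (theta p q / 4) eps X Y KX KY.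
Proof.
move=> pq CstX CstY e e0; have [p1 q1 _ _] := exponent_region_real pq.
have e20 : 0 < e / 2 by rewrite divr_gt0.
have [CL CL0 HL] := exists_log_bound e20.
set C0 := (Num.max 1 (CstX (2 * e)) * Num.max 1 (CstY (2 * e))) `^ (theta p q / 4).
have C00 : 0 <= C0 by exact: powR_ge0.
exists (CL ^+ 2 * C0) => G X Y KX KY KX1 KY1 hX hY f g fX gY.
have [k Xk hk] := HL #|` X|; have [l Yl hl] := HL #|` Y|.
set K := (KX * KY) `^ _; set n := (#|` X|)%:R * (#|` Y|)%:R.
have K0 : 0 <= K by exact: powR_ge0.
have p0 : 0 < p by rewrite (lt_le_trans _ p1).
have q0 : 0 < q by rewrite (lt_le_trans _ q1).
have M0 : 0 <= C0 * K * n `^ (e / 2) by rewrite !mulr_ge0 ?powR_ge0.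
apply: le_trans (conv_bound_of_indicators fX gY p1 q1 M0 Xk Yl _) _.
  by move=> A B AX BY; exact: (sqrt_joint_energy_le pq e0 KX1 KY1 hX hY).
rewrite ler_wpM2r ?(lpnormE gY) ?powR_ge0 // ler_wpM2r ?(lpnormE fX) ?powR_ge0 //.
apply: (@le_trans _ _ ((CL * CL * n `^ (e / 2)) * (C0 * K * n `^ (e / 2)))).
  apply: ler_wpM2r => //; rewrite /n powRM //.
  by rewrite [leRHS]mulrACA; apply: ler_pM => //; rewrite mulr_ge0.
have nE : n `^ e = n `^ (e / 2) * n `^ (e / 2).
  by rewrite -powRD -?splitr // gt_eqF.
by rewrite nE le_eqVlt; apply/orP; left; apply/eqP; ring.
Qed.
End Inequality.

(** * Sharpness of the exponent region *)

Section Sharpness.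
Variable R : realType.

Lemma powR_unbounded (C a : R) : 0 < a ->
  exists N : nat, forall n, (N <= n)%N -> C < n%:R `^ a.
Proof.
move=> a0; exists (Num.bound (`|C| `^ a^-1)) => n Nn.
apply: (le_lt_trans (ler_norm C)).
have -> : `|C| = (`|C| `^ a^-1) `^ a by rewrite -powRrM mulVf ?gt_eqF // powRr1.
apply: gt0_ltr_powR; rewrite ?nnegrE ?powR_ge0 //.
apply: lt_le_trans (archi_boundP (powR_ge0 _ _)) _; by rewrite ler_nat.
Qed.

Lemma powR_eventually_lt (C a b : R) : a < b ->
  exists N : nat, forall n, (N <= n)%N -> (0 < n)%N /\ C * n%:R `^ a < n%:R `^ b.
Proof.
move=> ab; have [N HN] : exists N : nat, forall n, (N <= n)%N -> C < n%:R `^ (b - a).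
  by apply: powR_unbounded; rewrite subr_gt0.
exists N.+1 => n Nn; have n0 : (0 < n)%N by exact: leq_trans Nn.
split=> //; have nR : 0 < n%:R :> R by rewrite ltr0n.
rewrite -[X in _ < _ `^ X](subrK a) powRD; last by rewrite (gt_eqF nR) implybT.
by rewrite ltr_pM2r ?powR_gt0 // HN // ltnW.
Qed.

Lemma powR_le_of_neg (kappa n x c : R) : kappa <= 0 -> 0 < n -> 0 < x -> 0 < c ->
  n <= c * x -> x `^ kappa <= c `^ (- kappa) * n `^ kappa.
Proof.
move=> k0 n0 x0 c0; have pos := (mulr_gt0, powR_gt0).
rewrite -ler_ln ?posrE ?pos // lnM ?posrE // => h.
rewrite -ler_ln ?posrE ?pos // lnM ?posrE ?pos // !ln_powR.
have := ler_wnM2l k0 h; lra.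
Qed.

Section Indicators.
Variable G : zmodType.
Implicit Types (A B X Y : {fset G}).

Lemma supported_cind_sub A X : (A `<=` X)%fset -> supported_on (cind R A) X.
Proof. by move=> AX x xX; apply: supported_cind; apply: contra xX; exact: (fsubsetP AX). Qed.

Lemma conv_bound_cind C (p q : \bar R) kappa e X Y A B (KX KY : R) :
  conv_bound C p q kappa e X Y KX KY -> (A `<=` X)%fset -> (B `<=` Y)%fset ->
  Num.sqrt (joint_energy A B)%:R <= C * (KX * KY) `^ kappa *
    ((#|` X|)%:R * (#|` Y|)%:R) `^ e * lpnorm p (cind R A) * lpnorm q (cind R B).
Proof.
move=> H AX BY; rewrite -lpnorm2_convolution_cind.
by apply: H; exact: supported_cind_sub.
Qed.

(** Finite and infinite exponents are treated together: tau is 1/p. *)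
Lemma lpnorm_cind_power (p : \bar R) : (1 <= p)%E -> exists tau : R,
  ((2%:E < p)%E -> tau < 2^-1) /\
  (forall A, A != fset0 -> lpnorm p (cind R A) = (#|` A|)%:R `^ tau).
Proof.
case: p => [r| |] //; rewrite ?lee_fin => r1.
  have r0 : 0 < r by rewrite (lt_le_trans _ r1).
  exists r^-1; split=> [|A _]; last exact: lpnorm_cind.
  by rewrite lte_fin => r2; rewrite ltf_pV2 ?posrE.
exists 0; split=> [_|A /fset0Pn[x xA]]; first by rewrite invr_gt0.
rewrite powRr0; apply/eqP; rewrite eq_le lpnorm_cind_infty /=.
apply: ub_le_sup; first by exists 1 => _ [y _ <-]; rewrite normc_nat lern1 leq_b1.
by exists x => //; rewrite normc_nat xA.
Qed.
End Indicators.

Lemma torsion_free_natmul_inj (G : zmodType) (d : G) : torsion_free G -> d != 0 ->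
  injective (GRing.natmul d).
Proof.
move=> tf d0 m n; wlog mn : m n / (m <= n)%N => [H|] E.
  by have [mn|/ltnW nm] := leqP m n; [exact: H|apply/esym/H].
have : d *+ (n - m) = 0 by rewrite mulrnBr // E subrr.
have [|nm] := posnP (n - m); last by move/(tf _ _ nm) => d00; rewrite d00 eqxx in d0.
lia.
Qed.

(** Uniqueness of sums of two powers of two, by stripping common factors 2;
    this is the Sidon property. *)
Lemma sum_two_powers_mem a b c d : (2 ^ c + 2 ^ d = 2 ^ a + 2 ^ b)%N -> c = a \/ c = b.
Proof.
have pos n : (0 < 2 ^ n)%N by rewrite expn_gt0.
elim: c a b d => [|c IH] [|a] [|b] [|d]; rewrite ?expnS ?expn0 => E; auto;
  try by repeat match type of E with context [(2 ^ ?n)%N] =>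
    move: (2 ^ n)%N (pos n) E => ? ? E end; lia.
- right; apply: (@expnI 2) => //; rewrite !expnS; lia.
- left; apply: (@expnI 2) => //; rewrite !expnS; lia.
- have /IH : (2 ^ c + 2 ^ d = 2 ^ a + 2 ^ b)%N by lia.
  by case=> ->; auto.
Qed.

Section Sidon.
Variables (G : zmodType) (d : G).
Hypotheses (tf : torsion_free G) (d0 : d != 0).
Implicit Types (A : {fset G}).

Definition powers_of_two n : {fset G} := [fset d *+ 2 ^ i | i in iota 0 n]%fset.

Lemma card_powers_of_two n : #|` powers_of_two n| = n.
Proof.
rewrite card_imfset /= ?size_undup ?undup_id ?iota_uniq ?size_iota //.
move=> i j /(torsion_free_natmul_inj tf d0); exact: expnI.
Qed.

Lemma diff_rep_powers_of_two n A t : (A `<=` powers_of_two n)%fset -> t != 0 ->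
  (diff_rep A t <= 1)%N.
Proof.
move=> AS t0; rewrite diff_repE.
have memS y : y \in A -> exists i, y = d *+ 2 ^ i.
  by move=> /(fsubsetP AS)/imfsetP[i _ ->]; exists i.
have [/hasP[y0 y0A y0t]|/hasPn h] := boolP (has (fun y => y + t \in A) A); last first.
  by rewrite big1_seq // => y /andP[_ /h /negbTE ->].
apply: (@leq_trans (\sum_(y <- A) (y == y0) * 1)%N); last first.
  by rewrite (sum_eq_fset A (fun=> 1%N)) muln1 leq_b1.
rewrite big_seq [leqRHS]big_seq; apply: leq_sum => y yA.
have [ytA|//] := boolP (y + t \in A); rewrite muln1 lt0b.
have [i yi] := memS _ yA; have [j yj] := memS _ y0A.
have [k yk] := memS _ ytA; have [l yl] := memS _ y0t.
have : d *+ (2 ^ i + 2 ^ l) = d *+ (2 ^ k + 2 ^ j).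
  by rewrite !mulrnDr -yi -yj -yk -yl addrA addrAC.
move/(torsion_free_natmul_inj tf d0)/sum_two_powers_mem => [ik|ij]; last by rewrite yi yj ij.
by move: yk; rewrite -ik -yi => /eqP; rewrite -subr_eq0 addrAC subrr add0r (negbTE t0).
Qed.

(** The difference 0 contributes |A|^2; every other one is represented at most
    once, so these contribute at most the number of pairs. *)
Lemma energy_powers_of_two n A : (A `<=` powers_of_two n)%fset ->
  (energy A <= 2 * #|` A| ^ 2)%N.
Proof.
move=> AS; rewrite (energyE (fsubset_refl _)).
apply: (@leq_trans (\sum_(t <- diffset A) (diff_rep A t + (t == 0)%R * #|` A| ^ 2))%N).
  apply: leq_sum => t _; have [->|t0] := eqVneq t 0.
    by rewrite diff_rep0 mul1n leq_addl.
  by have := diff_rep_powers_of_two AS t0; case: (diff_rep A t) => [|[]].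
rewrite big_split /= sum_diff_rep // (sum_eq_fset _ (fun=> _)).
by rewrite mul2n -addnn leq_add2l -[leqRHS]mul1n leq_mul2r leq_b1 orbT.
Qed.

Lemma hereditary_powers_of_two n : hereditary (fun=> 2 : R) 1 (powers_of_two n).
Proof.
move=> eta eta0 A AS; have := energy_powers_of_two AS.
rewrite -(ler_nat R) natrM natrX mulr1 => /le_trans; apply.
rewrite ler_wpM2l //; have [A0|A0] := posnP #|` A|.
  by rewrite A0 expr0n powR_ge0.
by rewrite -powR_mulrn // ler_powR ?ler1n // lerDl ltW.
Qed.
End Sidon.

Lemma exponent_region_sharp (p q : \bar R) :
  (1 <= p)%E -> (1 <= q)%E -> ~ exponent_region p q ->
  forall (G : zmodType), torsion_free G -> (exists x : G, x != 0) ->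
  forall kappa : R,
    ~ conv_estimate_on (energy_class (G := G) (fun=> 2)) (energy_class (fun=> 2)) p q kappa.
Proof.
move=> p1 q1 npq G tf [d d0] kappa H.
have pq2 : (2%:E < p)%E \/ (2%:E < q)%E.
  apply: contrapT => /not_orP[/negP]; rewrite -leNgt => p2 /negP; rewrite -leNgt => q2.
  apply: npq; split; rewrite ?p1 ?q1 //.
  case: p p1 p2 {H} => [r| |] // r1 r2; case: q q1 q2 => [s| |] // s1 s2.
  rewrite !lee_fin in r1 r2 s1 s2.
  have r0 : 0 < r by rewrite (lt_le_trans _ r1).
  have s0 : 0 < s by rewrite (lt_le_trans _ s1).
  rewrite !inver !gt_eqF //.
  rewrite -EFinD lee_fin.
  have hr : 2^-1 <= r^-1 by rewrite lef_pV2 ?posrE.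
  have hs : 2^-1 <= s^-1 by rewrite lef_pV2 ?posrE.
  lra.
have [tp [tp2 hp]] := lpnorm_cind_power G p1.
have [tq [tq2 hq]] := lpnorm_cind_power G q1.
pose S := powers_of_two d.
have inclass n : energy_class (fun=> 2 : R) (S n, 1).
  by split=> //=; exact: hereditary_powers_of_two.
have cardS n : #|` S n| = n by exact: card_powers_of_two.
have S0 n : (0 < n)%N -> S n != fset0 by rewrite -{1}[n]cardS cardfs_gt0.
have S1 : S 1%N = [fset d *+ 2 ^ 0]%fset.
  apply/fsetP => x; rewrite !inE; apply/imfsetP/eqP => [|->]; last by exists 0%N.
  by case=> i /=; rewrite inE => /eqP ->.
(* convolving 1_S with a point mass makes the l2 norm |S|^(1/2) and the
   corresponding factor on the right |S|^tau *)
have absurd tau : tau < 2^-1 ->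
    (forall e : R, 0 < e -> exists C, forall n, (0 < n)%N ->
      Num.sqrt n%:R <= C * n%:R `^ e * n%:R `^ tau) -> False.
  move=> tau2 E; have e0 : 0 < (2^-1 - tau) / 2 by rewrite divr_gt0 // subr_gt0.
  have [C hC] := E _ e0.
  have ab : (2^-1 - tau) / 2 + tau < 2^-1 by lra.
  have [N hN] := powR_eventually_lt C ab.
  have [N0] := hN _ (leqnn N); have := hC _ N0.
  rewrite -mulrA -powRD; last by rewrite pnatr_eq0 -lt0n N0 implybT.
  by rewrite -powR12_sqrt // => h1 h2; move: (le_lt_trans h1 h2); rewrite ltxx.
case: pq2 => [/tp2|/tq2] /absurd; apply=> e e0; have [C hC] := H _ e0; exists C => n n0.
  have := conv_bound_cind (hC _ _ _ _ (inclass n) (inclass 1%N))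
    (fsubset_refl _) (fsubset_refl _).
  rewrite hp ?S0 // hq ?S0 // !cardS joint_energyC S1 joint_energy1 cardS.
  by rewrite !mulr1 !powR1 !mulr1.
have := conv_bound_cind (hC _ _ _ _ (inclass 1%N) (inclass n))
  (fsubset_refl _) (fsubset_refl _).
rewrite hp ?S0 // hq ?S0 // !cardS S1 joint_energy1 cardS.
by rewrite !mulr1 mul1r !powR1 !mulr1.
Qed.

(** * Sharpness of the joint power of the parameters *)

Lemma lmod_torsion_free (F : fieldType) (W : lmodType F) :
  [pchar F] =i pred0 -> torsion_free W.
Proof.
move=> /pcharf0P ch x n n0 /eqP; rewrite -scaler_nat scaler_eq0 ch => /orP[/eqP n00|/eqP //].
by rewrite n00 in n0.
Qed.

Lemma card_arith_progression (G : zmodType) n (P : {fset G}) :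
  torsion_free G -> arith_progression n P -> #|` P| = n.
Proof.
move=> tf [a [d [d0 ->]]].
rewrite card_imfset /= ?size_undup ?undup_id ?iota_uniq ?size_iota //.
by move=> i j /addrI /(torsion_free_natmul_inj tf d0).
Qed.

(** The n^2 pairs are spread over at most 2 n differences: Cauchy-Schwarz. *)
Lemma energy_arith_progression (G : zmodType) n (P : {fset G}) :
  torsion_free G -> arith_progression n P -> (n ^ 3 <= 2 * energy P)%N.
Proof.
move=> tf AP; have cP := card_arith_progression tf AP; case: AP => a [d [d0 PE]].
pose D := [fset (d *+ i - d *+ n)%R | i in iota 0 (2 * n)]%fset.
have PD : (diffset P `<=` D)%fset.
  apply/fsubsetP => _ /imfset2P[x + [y + ->]]; rewrite PE.
  move=> /imfsetP[i /= + ->] /imfsetP[j /= + ->]; rewrite !mem_iota !add0n => /= hi hj.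
  apply/imfsetP; exists (i + (n - j))%N; first by rewrite /= mem_iota; lia.
  rewrite mulrnDr mulrnBr ?(ltnW hj) // opprD addrACA subrr add0r.
  by rewrite [X in _ = _ + X - _]addrC addrA addrK.
have cD : (#|` D| <= 2 * n)%N.
  apply: leq_trans (leq_imfset_card _ _ _) _.
  by rewrite /= ?size_undup ?undup_id ?iota_uniq ?size_iota.
have := @cauchy_schwarz_sum R _ D (fun=> 1) (fun t => (diff_rep P t)%:R).
under eq_bigr do rewrite mul1r.
under [X in _ <= X * _]eq_bigr do rewrite expr1n.
under [X in _ <= _ * X]eq_bigr do rewrite -natrX.
have -> : \sum_(t <- D) (1 : R) = (#|` D|)%:R by rewrite -sum1_size natr_sum.
rewrite -!natr_sum (sum_diff_rep PD) -(energyE PD) cP -natrX -natrM ler_nat => h.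
have [->//|n0] := posnP n.
have := leq_trans h (leq_mul cD (leqnn _)).
by rewrite -expnM (expnS n 3) (mulnC 2%N n) -mulnA leq_pmul2l.
Qed.

Lemma joint_power_sharp (F : fieldType) (W : lmodType F) (V : set W)
    (CC : set ({fset W} * R)) (Cst : R -> R) :
  [pchar F] =i pred0 -> CC `<=` energy_class Cst ->
  contains_progressions_on_rulings V CC ->
  forall p q : R, exponent_region p%:E q%:E ->
  forall kappa : R, kappa < theta p q / 4 ->
    ~ conv_estimate_on CC CC p%:E q%:E kappa.
Proof.
move=> /(@lmod_torsion_free F W) tf CCE [c long] p q pq kappa kt H.
have [p1 q1 _ _] := exponent_region_real pq.
have p0 : 0 < p by rewrite (lt_le_trans _ p1).
have q0 : 0 < q by rewrite (lt_le_trans _ q1).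
have [k0|k0] := ltP kappa 0.
  (* f = g is a point mass in P: the parameter K is at least of order n^(1/2) *)
  pose c2 := 2 * Num.max 1 (Cst 2^-1).
  have c20 : 0 < c2 by rewrite mulr_gt0 // lt_max ltr01.
  have e0 : 0 < - kappa / 4 by rewrite divr_gt0 // oppr_gt0.
  have [C hC] := H _ e0.
  have k20 : kappa / 2 < 0 by lra.
  have [N hN] := powR_eventually_lt (`|C| * (c2 ^+ 2) `^ (- kappa)) k20.
  have [n [L [P [K [Nn _ [AP _] CP _]]]]] := long N.
  have [n0 {}hN] := hN _ Nn.
  have [K1 hP] := CCE _ CP; rewrite /= in K1 hP.
  have cP := card_arith_progression tf AP.
  have nR : 0 < n%:R :> R by rewrite ltr0n.
  have KK : n%:R <= c2 ^+ 2 * (K * K).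
    (* the hereditary bound for P itself, with eta = 1/2 *)
    have Klow : n%:R `^ 2^-1 <= c2 * K.
      have := hP 2^-1 _ P (fsubset_refl _); rewrite invr_gt0 ltr0n cP => /(_ isT) hE.
      have := energy_arith_progression tf AP; rewrite -(ler_nat R) natrM natrX => h3.
      have : n%:R ^+ 3 <= c2 * K * n%:R `^ (2 + 2^-1).
        apply: (le_trans h3); rewrite -!mulrA ler_wpM2l // mulrA; apply: (le_trans hE).
        by rewrite ler_wpM2r ?powR_ge0 // ler_wpM2r ?(le_trans ler01) // le_max lexx orbT.
      have -> : n%:R ^+ 3 = n%:R `^ 2^-1 * n%:R `^ (2 + 2^-1) :> R.
        rewrite -powRD; last by rewrite (gt_eqF nR) implybT.
        by rewrite -powR_mulrn //; congr (_ `^ _); lra.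
      by rewrite ler_pM2r // powR_gt0.
    have : n%:R <= (c2 * K) * (c2 * K).
      have <- : n%:R `^ 2^-1 * n%:R `^ 2^-1 = n%:R :> R.
        rewrite -powRD; last by rewrite (gt_eqF nR) implybT.
        by rewrite (_ : 2^-1 + 2^-1 = 1) ?powRr1 //; lra.
      by apply: ler_pM; rewrite ?powR_ge0.
    by move=> /le_trans; apply; rewrite le_eqVlt; apply/orP; left; apply/eqP; ring.
  have [x xP] : exists x, x \in P by apply/fset0Pn; rewrite -cardfs_gt0 cP.
  have xP1 : ([fset x] `<=` P)%fset by rewrite fsub1set.
  have K0 : 0 < K by rewrite (lt_le_trans _ K1).
  have Kk := powR_le_of_neg (ltW k0) nR (mulr_gt0 K0 K0) (exprn_gt0 2 c20) KK.
  have := conv_bound_cind (hC _ _ _ _ CP CP) xP1 xP1.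
  rewrite joint_energy1 !lpnorm_cind // !cardfs1 sqrtr1 !powR1 !mulr1 cP.
  apply/negP; rewrite -ltNge; rewrite powRr0 in hN; apply: le_lt_trans hN.
  apply: (@le_trans _ _ (`|C| * ((c2 ^+ 2) `^ (- kappa) * n%:R `^ kappa) *
    (n%:R * n%:R) `^ (- kappa / 4))).
    rewrite ler_wpM2r ?powR_ge0 //.
    apply: le_trans (ler_wpM2l (normr_ge0 C) Kk).
    by apply: ler_wpM2r; rewrite ?powR_ge0 ?ler_norm.
  rewrite powRM // -!mulrA !ler_wpM2l ?powR_ge0 //.
  rewrite -!powRD ?(gt_eqF nR) ?implybT //.
  by rewrite le_eqVlt; apply/orP; left; apply/eqP; congr (_ `^ _); lra.
(* f = g = 1_P; here theta is positive, hence given by its linear expression *)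
have thE : theta p q = 3 - 2 * (p^-1 + q^-1).
  by move: kt; rewrite /theta; case: (leP 0 (3 - 2 * (p^-1 + q^-1))) => [//|h h']; lra.
have e0 : 0 < (theta p q / 4 - kappa) / 2 by rewrite divr_gt0 // subr_gt0.
have [C hC] := H _ e0; set e := (_ - _) / 2 in e0 hC.
have ab : kappa + (kappa + (e + (e + (p^-1 + q^-1)))) < 3 / 2 by rewrite /e; lra.
have [N hN] := powR_eventually_lt (Num.sqrt 2 * `|C| * (c * c) `^ kappa) ab.
have [n [L [P [K [Nn _ [AP _] CP Kn]]]]] := long N.
have [n0 {}hN] := hN _ Nn.
have [K1 hP] := CCE _ CP; rewrite /= in K1 hP.
have cP := card_arith_progression tf AP.
have nR : 0 < n%:R :> R by rewrite ltr0n.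
have K0 : 0 < K by rewrite (lt_le_trans _ K1).
have c0 : 0 < c by rewrite -(pmulr_lgt0 _ nR) (lt_le_trans K0).
have low : n%:R `^ (3 / 2) <= Num.sqrt 2 * Num.sqrt (energy P)%:R :> R.
  rewrite powRrM powR12_sqrt ?powR_ge0 // -sqrtrM // ler_sqrt ?mulr_ge0 //.
  by rewrite powR_mulrn // -natrX -natrM ler_nat energy_arith_progression.
have := conv_bound_cind (hC _ _ _ _ CP CP) (fsubset_refl _) (fsubset_refl _).
rewrite joint_energy_diag !lpnorm_cind // cP => up.
have Kk : (K * K) `^ kappa <= (c * c) `^ kappa * (n%:R `^ kappa * n%:R `^ kappa).
  rewrite -powRM // -powRM ?mulr_ge0 ?(ltW c0) //.
  apply: ge0_ler_powR; rewrite ?nnegrE ?mulr_ge0 ?(ltW c0) ?(ltW K0) //.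
  by rewrite mulrACA ler_pM ?(ltW K0).
have := lt_le_trans hN low; apply/negP; rewrite -leNgt.
rewrite -!mulrA ler_wpM2l ?sqrtr_ge0 //; apply: (le_trans up).
rewrite [(n%:R * n%:R) `^ _]powRM // -!mulrA.
apply: (@le_trans _ _ (`|C| * ((K * K) `^ kappa *
    (n%:R `^ e * (n%:R `^ e * (n%:R `^ p^-1 * n%:R `^ q^-1)))))).
  by rewrite ler_wpM2r ?ler_norm // !mulr_ge0 ?powR_ge0.
rewrite ler_wpM2l // !powRD ?(gt_eqF nR) ?implybT //.
apply: (le_trans (ler_wpM2r _ Kk)); first by rewrite !mulr_ge0 ?powR_ge0.
by rewrite -!mulrA.
Qed.
End Sharpness.

Theorem theorem1p3 (R : realType) :
  (* the inequality *)
  (forall p q : R, exponent_region p%:E q%:E ->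
   forall (CstX CstY : R -> R) (eps : R), 0 < eps ->
   exists C : R,
     forall (G : zmodType) (X Y : {fset G}) (KX KY : R),
       torsion_free G -> 1 <= KX -> 1 <= KY ->
       hereditary CstX KX X -> hereditary CstY KY Y ->
       conv_bound C p%:E q%:E (theta p q / 4) eps X Y KX KY)
  /\
  (* sharpness of the exponent region, whatever the power of KX * KY *)
  (forall p q : \bar R, (1 <= p)%E -> (1 <= q)%E -> ~ exponent_region p q ->
   exists CstX CstY : R -> R,
     forall (G : zmodType), torsion_free G -> (exists x : G, x != 0) ->
     forall kappa : R,
       ~ conv_estimate_on (energy_class (G := G) CstX) (energy_class CstY)
           p q kappa)
  /\
  (* sharpness of the joint power of KX * KY *)
  (forall (F : fieldType) (W : lmodType F) (V : set W)
          (CC : set ({fset W} * R)) (Cst : R -> R),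
     [pchar F] =i pred0 ->
     (forall X K, CC (X, K) -> [set` X] `<=` V) ->
     CC `<=` energy_class Cst ->
     contains_progressions_on_rulings V CC ->
     forall p q : R, exponent_region p%:E q%:E ->
     forall kappa : R, kappa < theta p q / 4 ->
       ~ conv_estimate_on CC CC p%:E q%:E kappa).
Proof.
split; [|split].
- move=> p q pq CstX CstY e e0.
  have [C hC] := convolution_estimate pq CstX CstY e0.
  by exists C => G X Y KX KY _; exact: hC.
- move=> p q p1 q1 npq; exists (fun=> 2), (fun=> 2); exact: exponent_region_sharp.
- move=> F W V CC Cst ch _ CCE long p q pq; exact: (joint_power_sharp ch CCE long pq).
Qed.
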